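(* Let $E$ be an Archimedean Riesz space and let $F$ be a vector subspace of $E$. Define a sequence $(L_n)_{n\ge 1}$ of vector subspaces of $E$ by $L_1=F$ and, for $n\ge 1$, $L_{n+1}$ is the vector subspace of $E$ generated by $L_n\cup |L_n|$, where $|L_n|=\{|x| : x\in L_n\}$. Then the Riesz subspace $\mathcal{R}(F)$ of $E$ generated by $F$ satisfies $$\mathcal{R}(F)=\bigcup_{n=1}^{\infty}L_n .$$
   Context: A Riesz space is a real vector lattice; $|x|=x\vee(-x)$. For a subset $D$ of a Riesz space $E$, $\mathcal{R}(D)$ denotes the Riesz subspace generated by $D$, i.e. the smallest Riesz subspace (vector sublattice) of $E$ containing $D$. *)

(* Defs.v *)
From HB Require Import structures.
From mathcomp Require Import all_boot all_order all_algebra.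
From mathcomp Require Import boolp classical_sets reals.

Set Implicit Arguments.
Unset Strict Implicit.
Unset Printing Implicit Defensive.

Import Order.TTheory GRing.Theory Num.Theory.
Local Open Scope classical_set_scope.
Local Open Scope ring_scope.

(* Order.Lattice and GRing.Zmodule are first joined in Num.RealDomain, so HB
   rejects a structure inheriting directly from both. The lattice operations
   are therefore fields here, with the axioms of Order.Lattice, and the
   latticeType instance is declared on the carrier afterwards. *)
HB.mixin Record isRieszSpace (R : realType) E
    of Num.POrderedZmodule E & GRing.Lmodule R E := {
  riesz_meet : E -> E -> E;
  riesz_join : E -> E -> E;
  riesz_lexI : forall x y z : E,
    (x <= riesz_meet y z) = (x <= y) && (x <= z);
  riesz_leUx : forall x y z : E,
    (riesz_join x y <= z) = (x <= z) && (y <= z);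
  riesz_leD2l : forall x y z : E, x <= y -> z + x <= z + y;
  riesz_leZ2l : forall (a : R) (x y : E), 0 <= a -> x <= y -> a *: x <= a *: y;
}.

#[short(type="rieszSpaceType")]
HB.structure Definition RieszSpace (R : realType) :=
  { E of Num.POrderedZmodule E & GRing.Lmodule R E & isRieszSpace R E }.

#[non_forgetful_inheritance]
HB.instance Definition _ (R : realType) (E : rieszSpaceType R) :=
  Order.POrder_isMeetSemilattice.Build ring_display (RieszSpace.sort E)
    (@riesz_lexI R E).
#[non_forgetful_inheritance]
HB.instance Definition _ (R : realType) (E : rieszSpaceType R) :=
  Order.POrder_isJoinSemilattice.Build ring_display (RieszSpace.sort E)
    (@riesz_leUx R E).

Section RieszSpaceDefs.
Variables (R : realType) (E : rieszSpaceType R).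
Implicit Types (x : E) (D S : set E).

Definition riesz_abs x : E := Order.join x (- x).

(* n^-1 *: x decreases to 0 for every x >= 0; the index is shifted so that
   only n >= 1 occurs. *)
Definition riesz_archimedean : Prop :=
  forall x, 0 <= x -> infimums (range (fun n : nat => n.+1%:R^-1 *: x)) 0.

Definition vector_subspace S : Prop := GRing.submod_closed (mem S).

Definition riesz_subspace S : Prop :=
  [/\ vector_subspace S,
      Order.ClosedPredicates.meet_closed (mem S)
    & Order.ClosedPredicates.join_closed (mem S)].

Definition vector_span D : set E := smallest vector_subspace D.

Definition riesz_span D : set E := smallest riesz_subspace D.

End RieszSpaceDefs.

Arguments riesz_archimedean {R} E.

(* Main.v *)
(* A subspace S is a Riesz subspace iff it is closed under absolute value, because
   2 (x \/ y) = x + y + |x - y| and x /\ y = - (- x \/ - y). The union of the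
   increasing sequence L is a subspace, and it is closed under absolute value
   since |L_n| is contained in L_(n+1). *)
Require Import Defs.
From HB Require Import structures.
From mathcomp Require Import all_boot all_order all_algebra.
From mathcomp Require Import boolp classical_sets reals.

Import Order.TTheory GRing.Theory Num.Theory.
Local Open Scope classical_set_scope.
Local Open Scope ring_scope.

Section RieszSpaceTheory.
Context {R : realType} {E : rieszSpaceType R}.
Implicit Types (x y z : E) (S : set E).

Lemma riesz_lerD2l z x y : (z + x <= z + y) = (x <= y).
Proof.
apply/idP/idP => [/(@riesz_leD2l _ E _ _ (- z))|]; last exact: riesz_leD2l.
by rewrite !addKr.
Qed.

Lemma riesz_lerN2 x y : (- x <= - y) = (y <= x).
Proof. by rewrite -(riesz_lerD2l (x + y) (- x)) addrAC subrr add0r addrK. Qed.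

Lemma riesz_lerZ2l (a : R) x y : 0 < a -> (a *: x <= a *: y) = (x <= y).
Proof.
move=> a0; apply/idP/idP; last exact/riesz_leZ2l/ltW.
have ai0 : 0 <= a^-1 by rewrite invr_ge0 ltW.
move=> /(@riesz_leZ2l _ E _ _ _ ai0).
by rewrite !scalerA mulVf ?gt_eqF// !scale1r.
Qed.

(** Translation by [z] is an order automorphism with inverse translation by [- z], so it preserves
    joins; [riesz_scale_join] rests on the same argument for multiplication by [a] and [a^-1]. *)
Lemma riesz_addr_join z x y :
  z + Order.join x y = Order.join (z + x) (z + y).
Proof.
apply/le_anti/andP; split; last by rewrite leUx !riesz_lerD2l leUl leUr.
rewrite -(riesz_lerD2l (- z)) addKr leUx.
by rewrite -(riesz_lerD2l z x) -(riesz_lerD2l z y) addNKr leUl leUr.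
Qed.

Lemma riesz_scale_join (a : R) x y : 0 < a ->
  a *: Order.join x y = Order.join (a *: x) (a *: y).
Proof.
move=> a0; have ai0 : 0 < a^-1 by rewrite invr_gt0.
apply/le_anti/andP; split; last by rewrite leUx !riesz_lerZ2l// leUl leUr.
rewrite -(riesz_lerZ2l _ _ _ ai0) scalerA mulVf ?gt_eqF// scale1r leUx.
rewrite -(riesz_lerZ2l _ x _ a0) -(riesz_lerZ2l _ y _ a0) scalerA mulfV ?gt_eqF// scale1r.
by rewrite leUl leUr.
Qed.

(** Negation is an order-reversing involution, so it exchanges joins and meets. *)
Lemma riesz_oppr_join x y : - Order.join x y = Order.meet (- x) (- y).
Proof.
apply/le_anti/andP; split; first by rewrite lexI !riesz_lerN2 leUl leUr.
by rewrite -riesz_lerN2 opprK leUx -(riesz_lerN2 _ x) -(riesz_lerN2 _ y) opprK leIl leIr.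
Qed.

Lemma riesz_joinE x y :
  Order.join x y = 2^-1 *: (x + y + riesz_abs (x - y)).
Proof.
(* Moving [x + y] inside the join of [x - y] and [y - x] leaves the join of [2 *: x] and
   [2 *: y]. *)
have -> : x + y + riesz_abs (x - y) = 2 *: Order.join x y.
  rewrite riesz_scale_join// /riesz_abs riesz_addr_join opprB.
  by rewrite !scaler_nat !mulr2n addrACA subrr addr0 [x + y]addrC addrACA subrr
    addr0.
by rewrite scalerA mulVf ?pnatr_eq0// scale1r.
Qed.

(** Trades the boolean membership in [mem S] for plain propositions on the set [S]. *)
Lemma vector_subspaceP S :
  vector_subspace S <->
  S 0 /\ forall (a : R) x y, S x -> S y -> S (a *: x + y).
Proof.
split=> -[S0 SD]; split.
- by move: S0; rewrite inE.
- by move=> a x y Sx Sy; have := SD a x y; rewrite !inE; apply.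
- by rewrite inE.
- by move=> a x y; rewrite !inE; exact: SD.
Qed.

(** The span is an intersection of subspaces, and the closure conditions pass to intersections. *)
Lemma vector_span_subspace S : vector_subspace (vector_span S).
Proof.
apply/vector_subspaceP; split=> [T [/vector_subspaceP[T0 _] _] //|].
move=> a x y Sx Sy T TS; have /vector_subspaceP[_] := TS.1; apply.
  exact: Sx.
exact: Sy.
Qed.

Lemma riesz_subspaceP S :
  riesz_subspace S <->
  vector_subspace S /\ forall x, S x -> S (riesz_abs x).
Proof.
split=> [[vS _ SU]|[vS Sabs]].
  have /vector_subspaceP[S0 SD] := vS; split=> // x Sx.
  have SNx : S (- x) by rewrite -scaleN1r -[_ *: _]addr0; exact: SD.
  by have := SU x (- x); rewrite !inE; apply.
have /vector_subspaceP[S0 SD] := vS.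
have SZ (a : R) x : S x -> S (a *: x).
  by move=> Sx; rewrite -[_ *: _]addr0; exact: SD.
have SN x : S x -> S (- x) by rewrite -scaleN1r; exact: SZ.
have SA x y : S x -> S y -> S (x + y) by rewrite -{2}[x]scale1r; exact: SD.
have SU x y : S x -> S y -> S (Order.join x y).
  move=> Sx Sy; rewrite riesz_joinE.
  by apply/SZ/SA; [exact: SA|apply/Sabs/SA => //; exact: SN].
split=> // x y; rewrite !inE => Sx Sy; last exact: SU.
rewrite -[x]opprK -[y]opprK -riesz_oppr_join.
by apply/SN/SU; exact: SN.
Qed.

End RieszSpaceTheory.

Theorem theorem3p1 (R : realType) (E : rieszSpaceType R)
    (E_arch : riesz_archimedean E)
    (F : set E) (F_subspace : vector_subspace F)
    (L : nat -> set E) (L1 : L 1%N = F)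
    (LS : forall n : nat, (1 <= n)%N ->
      L n.+1 = vector_span (L n `|` [set riesz_abs x | x in L n])) :
  riesz_span F = \bigcup_(n in [set k : nat | (1 <= k)%N]) L n.
Proof.
have LnS n : (1 <= n)%N -> L n `<=` L n.+1.
  by move=> n1 x Lx; rewrite LS//; apply: sub_gen_smallest; left.
have Labs n x : (1 <= n)%N -> L n x -> L n.+1 (riesz_abs x).
  by move=> n1 Lx; rewrite LS//; apply: sub_gen_smallest; right; exists x.
have Lmono m n : (1 <= m)%N -> (m <= n)%N -> L m `<=` L n.
  move=> m1; elim: n => [|n IH]; first by rewrite leqNgt m1.
  rewrite leq_eqVlt => /predU1P[-> //|mn].
  by apply: subset_trans (IH mn) _; apply/LnS/(leq_trans m1 mn).
have Lsub n : (1 <= n)%N -> vector_subspace (L n).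
  (* [L 0] is unconstrained and excluded by [1 <= n]; [L 1] is [F], and every later term is a
     span. *)
  case: n => // -[_|n _]; first by rewrite L1.
  by rewrite LS//; exact: vector_span_subspace.
apply/seteqP; split.
  apply: smallest_sub; last by rewrite -L1; exact: bigcup_sup.
  apply/riesz_subspaceP; split; last first.
    by move=> x [n /= n1 Lx]; exists n.+1 => //; exact: Labs.
  apply/vector_subspaceP; split.
    by exists 1%N => //; have /vector_subspaceP[] := Lsub 1%N isT.
  move=> a x y [m /= m1 Lx] [n /= n1 Ly].
  (* By monotonicity both vectors lie in the term of larger index, which is a subspace. *)
  have mn1 : (1 <= maxn m n)%N by rewrite leq_max m1.
  exists (maxn m n) => //; have /vector_subspaceP[_] := Lsub _ mn1; apply.
    exact: Lmono (leq_maxl _ _) _ Lx.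
  exact: Lmono (leq_maxr _ _) _ Ly.
move=> x [n /= n1 Lx] T [/riesz_subspaceP[vT Tabs] FT].
(* Conversely, any Riesz subspace [T] containing [F] contains each [L n], by induction on [n]. The
   claim is about the whole of [L n] because the generators of [L n.+1] range over all its elements
   and their absolute values. *)
suff : L n `<=` T by exact.
elim: n n1 {x Lx} => // -[_ _|n IH _]; first by rewrite L1.
rewrite LS//; apply: smallest_sub => //.
by rewrite subUset; split=> [|_ [x Lx <-]]; [exact: IH|exact/Tabs/IH].
Qed.
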